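(* Let $\mathcal{F}$ be a set of graphs in which no element is an induced subgraph of another element. The following are equivalent: (1) $\mathcal{F}$ is DSF; (2) for each $G\in\mathcal{F}$, every element of $\mathcal{D}(G)$ contains an element of $\mathcal{F}$ as an induced subgraph; (3) $\mathcal{D}(\mathcal{F})=\mathcal{F}$.
   Context: All graphs are finite and simple, considered up to isomorphism. For a set $\mathcal{F}$ of graphs, a graph is $\mathcal{F}$-free if none of its induced subgraphs is isomorphic to a member of $\mathcal{F}$. A set $\mathcal{F}$ of graphs is degree-sequence-forcing (DSF) if whenever some realization of a degree sequence $d$ (a graph with degree sequence $d$) is $\mathcal{F}$-free, every realization of $d$ is $\mathcal{F}$-free. For a set $\mathcal{G}$ of graphs in which no element is induced in another, consider the set of all graphs that have the same degree sequence as some graph containing an element of $\mathcal{G}$ as an induced subgraph; $\mathcal{D}(\mathcal{G})$ denotes the set of minimal elements of this set under the induced-subgraph relation. For a single graph $G$, $\mathcal{D}(G)$ means $\mathcal{D}(\{G\})$. *)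

(* Defs.v *)
From mathcomp Require Import all_boot.

Set Implicit Arguments.
Unset Strict Implicit.
Unset Printing Implicit Defensive.

Record sgraph := SGraph {
  vertex :> finType;
  adj : rel vertex;
  adj_sym : symmetric adj;
  adj_irr : irreflexive adj
}.

Definition isomorphic (G H : sgraph) : Prop :=
  exists2 f : G -> H, bijective f & forall x y, adj (f x) (f y) = adj x y.

Section InducedSubgraph.
Variables (G : sgraph) (S : {set G}).

Let induced_adj : rel {x : G | x \in S} := fun x y => adj (val x) (val y).

Fact induced_adj_sym : symmetric induced_adj.
Proof. by move=> x y; apply: adj_sym. Qed.

Fact induced_adj_irr : irreflexive induced_adj.
Proof. by move=> x; apply: adj_irr. Qed.

Definition induced : sgraph := SGraph induced_adj_sym induced_adj_irr.
End InducedSubgraph.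

(* The induced-subgraph relation on graphs up to isomorphism. *)
Definition induced_in (H G : sgraph) : Prop :=
  exists S : {set G}, isomorphic (induced S) H.

Definition degree (G : sgraph) (x : G) : nat := #|[set y | adj x y]|.

Definition degree_seq (G : sgraph) : seq nat :=
  sort geq [seq degree x | x <- enum G].

Definition realizes (G : sgraph) (d : seq nat) : Prop := degree_seq G = d.

(* A set of graphs considered up to isomorphism is a predicate on graphs that
   satisfies [iso_closed]. *)
Definition graph_set := sgraph -> Prop.

Definition iso_closed (F : graph_set) : Prop :=
  forall G H, isomorphic G H -> F G -> F H.

Definition single (G : sgraph) : graph_set := fun H => isomorphic G H.

(* Up to isomorphism, "another element" means a non-isomorphic one. *)
Definition induced_antichain (F : graph_set) : Prop :=
  forall G H, F G -> F H -> ~ isomorphic G H -> ~ induced_in G H.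

Definition free (F : graph_set) (G : sgraph) : Prop :=
  forall H, F H -> ~ induced_in H G.

Definition DSF (F : graph_set) : Prop :=
  forall d : seq nat,
    (exists G, realizes G d /\ free F G) ->
    forall H, realizes H d -> free F H.

Definition minimal (A : graph_set) : graph_set :=
  fun G => A G /\ forall H, A H -> induced_in H G -> isomorphic H G.

Definition degree_class (A : graph_set) : graph_set :=
  fun G => exists H, degree_seq G = degree_seq H /\
    exists2 K, A K & induced_in K H.

Definition D (A : graph_set) : graph_set := minimal (degree_class A).

(* Main.v *)
Require Import Defs.
From mathcomp Require Import all_boot.
From Stdlib Require Import Classical.

Set Implicit Arguments.
Unset Strict Implicit.
Unset Printing Implicit Defensive.

(** The induced-subgraph relation is a preorder, well founded up to isomorphism
    because vertex counts decrease, so every graph of a set contains a minimal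
    element of that set. Hence condition (2) says that every graph in the degree
    class of [F] contains an element of [F]; this is the contrapositive of DSF,
    and for an antichain it identifies [F] with the minimal elements of its
    degree class. *)

Lemma isomorphic_sym (G H : sgraph) : isomorphic G H -> isomorphic H G.
Proof.
case=> f [g fK gK] f_adj; exists g; first by exists f.
by move=> x y; rewrite -f_adj !gK.
Qed.

(** Embeddings replace vertex subsets: they compose, and injectivity bounds cardinals. An embedding
    is bijective onto its image by counting. *)
Lemma induced_inP (H G : sgraph) :
  induced_in H G <->
  exists2 f : H -> G, injective f & forall x y, adj (f x) (f y) = adj x y.
Proof.
split=> [[S /isomorphic_sym[f f_bij f_adj]] | [f f_inj f_adj]].
  exists (fun x => val (f x)) => [x y /val_inj/(bij_inj f_bij)//|x y].
  exact: f_adj.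
pose S := [set f x | x in [set: H]]; exists S; apply: isomorphic_sym.
pose g (x : H) : induced S := Sub (f x) (imset_f f (in_setT x)).
exists g => [|x y]; last exact: f_adj.
apply: inj_card_bij => [x y [] /f_inj //|].
by rewrite card_sig -cardsT -(card_imset _ f_inj); apply/subset_leq_card/subsetP.
Qed.

Lemma isomorphic_induced_in (H G : sgraph) : isomorphic H G -> induced_in H G.
Proof. by case=> f /bij_inj f_inj f_adj; apply/induced_inP; exists f. Qed.

Lemma induced_in_refl (G : sgraph) : induced_in G G.
Proof. by apply/induced_inP; exists id. Qed.

Lemma induced_in_trans (H G K : sgraph) :
  induced_in G H -> induced_in H K -> induced_in G K.
Proof.
move=> /induced_inP[f f_inj f_adj] /induced_inP[g g_inj g_adj].
apply/induced_inP; exists (g \o f) => [|x y /=]; first exact: inj_comp.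
by rewrite g_adj.
Qed.

Lemma induced_in_card (H G : sgraph) : induced_in H G -> #|H| <= #|G|.
Proof. by case/induced_inP=> f /leq_card. Qed.

Lemma induced_in_card_isomorphic (H G : sgraph) :
  induced_in H G -> #|G| <= #|H| -> isomorphic H G.
Proof.
by case/induced_inP=> f f_inj f_adj leGH; exists f => //; apply: inj_card_bij.
Qed.

Lemma minimal_induced_in (A : graph_set) (G : sgraph) :
  A G -> exists2 M, minimal A M & induced_in M G.
Proof.
have [n] := ubnP #|G|; elim: n G => // n IHn G /ltnSE leGn AG.
(* [A] is an arbitrary predicate, so this case split is classical. *)
have [[H [AH [HG ltHG]]] | noH] :=
  classic (exists H, A H /\ induced_in H G /\ #|H| < #|G|).
  have [M minM MH] := IHn H (leq_trans ltHG leGn) AH.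
  by exists M => //; apply: induced_in_trans HG.
exists G; last exact: induced_in_refl.
split=> // H AH HG; apply: induced_in_card_isomorphic => //.
by rewrite leqNgt; apply/negP=> ltHG; apply: noH; exists H.
Qed.

Lemma sub_degree_class (A : graph_set) (G : sgraph) : A G -> degree_class A G.
Proof. by move=> AG; exists G; split=> //; exists G => //; apply: induced_in_refl. Qed.

Theorem theorem2p13 (F : graph_set)
    (F_iso : iso_closed F) (F_antichain : induced_antichain F) :
  [<-> DSF F;
       forall G, F G -> forall H, D (single G) H ->
         exists2 K, F K & induced_in K H;
       forall G, D F G <-> F G].
Proof.
tfae=> [F_DSF G FG H [[H' [eqd [K GK KH']]] _] | D_single | DF].
(* Otherwise [H] is [F]-free, so by DSF is [H'], which has the same degree sequence; but [H']
   contains a copy of [G]. *)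
- apply: NNPP => noK.
  have H_free : free F H by move=> L FL LH; apply: noK; exists L.
  apply: (F_DSF _ (ex_intro _ H (conj (erefl _) H_free)) H' (esym eqd) G FG).
  exact: induced_in_trans (isomorphic_induced_in GK) KH'.
(* Condition (2) passes from minimal elements to the whole degree class, since [X] lies above some
   [M] in [D (single K)]. *)
- have F_in X : degree_class F X -> exists2 K, F K & induced_in K X.
    case=> H [eqd [K FK KH]].
    have KX : degree_class (single K) X.
      exists H; split=> //; exists K => //; exists id => //; exact: inj_card_bij.
    have [M DM MX] := minimal_induced_in KX.
    have [L FL LM] := D_single K FK M DM.
    by exists L => //; apply: induced_in_trans MX.
  move=> G; split=> [[GF Gmin] | FG].
    have [K FK KG] := F_in G GF.
    exact: F_iso (Gmin K (sub_degree_class FK) KG) FK.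
  split=> [|H HF HG]; first exact: sub_degree_class.
  have [K FK KH] := F_in H HF.
  (* [K] embeds in [G] through [H], so the antichain condition gives [K] and [G] equal order; [H]
     lies between them. *)
  have KG : isomorphic K G.
    apply: NNPP => nKG; apply: (F_antichain K G FK FG nKG).
    exact: induced_in_trans HG.
  apply: induced_in_card_isomorphic => //.
  apply: leq_trans (induced_in_card KH).
  exact/induced_in_card/isomorphic_induced_in/isomorphic_sym.
- move=> d [G [Gd G_free]] H Hd K FK KH.
  (* [H] witnesses this: it shares the degree sequence [d] with [G] and contains [K]. *)
  have GF : degree_class F G.
    by exists H; split; [rewrite Gd Hd | exists K].
  have [M /DF FM MG] := minimal_induced_in GF.
  exact: G_free FM MG.
Qed.
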